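(* Let $r\ge1$ and let $G$ be a graph on $n$ vertices with minimum degree $\delta(G)\ge(1-1/2^r)n$ whose edges are coloured with $r$ colours. Then the vertices of $G$ can be covered by monochromatic components of (pairwise) distinct colours.
   Context: For a colour $i$, a monochromatic component of colour $i$ is a connected component of the spanning subgraph of $G$ formed by all edges of colour $i$ (singleton vertices are allowed as components). The edge-colouring is arbitrary (not necessarily proper). Components of different colours may overlap. *)

(* Defs.v *)
From mathcomp Require Import all_boot all_order all_algebra.
Set Implicit Arguments.
Unset Strict Implicit.
Unset Printing Implicit Defensive.

Definition degree (T : finType) (e : rel T) (v : T) : nat := #|[set w | e v w]|.

(* Every degree is at most #|T|, so the default value #|T| of the iterated
   minimum is harmless: this is the minimum degree as soon as T is nonempty. *)
Definition min_degree (T : finType) (e : rel T) : nat :=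
  \big[minn/#|T|]_(v : T) degree e v.

(* An edge xy is represented by the set [set x; y]; an edge-colouring assigns a
   colour to every set of vertices, and only its values on edges are used. *)
Definition edge_colouring (T : finType) (r : nat) : Type := {set T} -> 'I_r.

Definition colour_graph (T : finType) (r : nat) (e : rel T)
    (col : edge_colouring T r) (i : 'I_r) : rel T :=
  [rel x y | e x y && (col [set x; y] == i)].

Definition mono_component (T : finType) (r : nat) (e : rel T)
    (col : edge_colouring T r) (i : 'I_r) (A : {set T}) : Prop :=
  exists x : T, A = [set y | connect (colour_graph e col i) x y].

(* Main.v *)
Require Import Defs.
From mathcomp Require Import all_boot all_order all_algebra.
Import Order.TTheory GRing.Theory Num.Theory.
Local Open Scope ring_scope.

(** Record each vertex [v] as the tuple of its monochromatic components, one
    per colour.  A choice of one component of every colour is a tuple of the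
    same shape, and it covers [v] exactly when the two tuples agree in some
    coordinate; let us say then that it hits [v].

    Choices of components satisfy a Helly property ([hitting_helly]): if every
    set of at most [2 ^ r] vertices is hit by one choice, then so is the whole
    vertex set.  Indeed, let [S] be a minimal set that no choice hits.  By
    minimality every [v] in [S] comes with a choice that hits all of [S] except
    [v], and these vertices and choices satisfy the cross-agreement condition of
    a Bollobas-type inequality for set pairs ([card_cross_agreeing]), which
    bounds their number by [2 ^ r].

    It remains to hit a set [S] of at most [2 ^ r] vertices.  By the degree
    condition every vertex has fewer than [n / 2 ^ r] non-neighbours other than
    itself, so these non-neighbours do not exhaust the graph as [v] runs through
    [S]: some vertex [w] is equal or adjacent to every member of [S]
    ([common_closed_neighbour]).  The components of [w] hit [S], since an edge
    from [w] to [v] puts [v] into the component of [w] of the colour of that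
    edge. *)

(** * A set-pair inequality and the Helly property of tuples *)

(** Embed [X] into the rationals.  The matrix with entries
    [\prod_i (a j i - b l i)] vanishes off the diagonal and not on it, so it has
    rank [#|J|].  On the other hand each entry is a multilinear polynomial in
    the coordinates of [a j], so the matrix factors through the space spanned
    by the [2 ^ #|I|] squarefree monomials. *)
Lemma card_cross_agreeing (I J : finType) (X : countType) (a b : J -> I -> X) :
  (forall j i, a j i != b j i) ->
  (forall j l, j != l -> exists i, a j i = b l i) ->
  (#|J| <= 2 ^ #|I|)%N.
Proof.
move=> diag_neq off_agree.
pose q (x : X) : rat := (pickle x)%:R.
have q_inj : injective q.
  by move=> x y /eqP; rewrite eqr_nat => /eqP/(pcan_inj pickleK).
pose M := \matrix_(j < #|J|, l < #|J|)
  \prod_i (q (a (enum_val j) i) - q (b (enum_val l) i)).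
pose A := \matrix_(j < #|J|, s < #|{set I}|)
  \prod_(i in enum_val s) q (a (enum_val j) i).
pose B := \matrix_(s < #|{set I}|, l < #|J|)
  \prod_(i in ~: enum_val s) - q (b (enum_val l) i).
have M_factors : M = A *m B.
  apply/matrixP=> j l; rewrite !mxE bigA_distr.
  rewrite (reindex (@enum_val _ {set I})) /=; last first.
    exact/onW_bij/enum_val_bij.
  apply: eq_bigr => s _; rewrite !mxE (bigID (mem (enum_val s))) /=.
  congr (_ * _); first by apply: eq_bigr => i ->.
  by apply: eq_big => [i|i /negPf->//]; rewrite inE.
have M_diag : M = diag_mx (\row_j M j j).
  apply/matrixP=> j l; rewrite !mxE; have [->|neq_jl] := eqVneq j l.
    by rewrite mulr1n.
  rewrite mulr0n; have [|i ab_i] := off_agree (enum_val j) (enum_val l).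
    by rewrite (inj_eq enum_val_inj).
  by rewrite (bigD1 i) //= ab_i subrr mul0r.
have M_rank : \rank M = #|J|.
  apply/eqP; rewrite -[_ == _]/(row_free M) row_free_unit unitmxE M_diag.
  rewrite det_diag unitfE prodf_seq_neq0; apply/allP=> j _; rewrite !mxE /=.
  by rewrite prodf_seq_neq0; apply/allP=> i _; rewrite /= subr_eq0 (inj_eq q_inj).
rewrite -M_rank M_factors (leq_trans (mxrankM_maxl A B)) //.
by rewrite (leq_trans (rank_leq_col A)) // -[#|{set I}|]cardsT -powersetT card_powerset cardsT.
Qed.

(** A minimal set that no [t] hits is small by [card_cross_agreeing], applied to
    the tuples of its members and to the tuples that hit all other members. *)
Lemma hitting_helly (I V X : finType) (f : V -> I -> X) :
  (forall S : {set V}, (#|S| <= 2 ^ #|I|)%N ->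
     exists t : {ffun I -> X}, forall v, v \in S -> exists i, f v i = t i) ->
  exists t : {ffun I -> X}, forall v, exists i, f v i = t i.
Proof.
move=> small_hit.
pose hits (t : {ffun I -> X}) v := [exists i, f v i == t i].
pose unhit (S : {set V}) := ~~ [exists t, [forall v in S, hits t v]].
have [/minset_exists [S /minsetP [S_unhit S_min] _]|] := boolP (unhit setT);
  last first.
  rewrite negbK => /existsP [t /forall_inP t_hits]; exists t => v.
  by have /existsP [i /eqP] := t_hits v (in_setT v); exists i.
have rest_hit (u : {v | v \in S}) :
    {t | [forall v in S :\ sval u, hits t v]}.
  apply/sigW/existsP/contraT => /S_min/(_ (subsetDl _ _)) /setP/(_ (sval u)).
  by rewrite !inE eqxx (svalP u).
have S_small : (#|S| <= 2 ^ #|I|)%N.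
  rewrite -card_sig.
  apply: (@card_cross_agreeing I _ X (fun u => f (sval u))
            (fun u => sval (rest_hit u))) => [u i|u w neq_uw].
    apply: contra S_unhit => fu_i; apply/existsP; exists (sval (rest_hit u)).
    apply/forall_inP => v vS; have [->|neq_vu] := eqVneq v (sval u).
      by apply/existsP; exists i.
    by apply: (forall_inP (svalP (rest_hit u))); rewrite !inE neq_vu.
  have /existsP [i /eqP] : hits (sval (rest_hit w)) (sval u); last by exists i.
  apply: (forall_inP (svalP (rest_hit w))).
  by rewrite !inE (inj_eq val_inj) neq_uw (svalP u).
case/negP: S_unhit; have [t t_hits] := small_hit S S_small.
apply/existsP; exists t; apply/forall_inP=> v /t_hits [i fv_i].
by apply/existsP; exists i; rewrite fv_i.
Qed.

(** * Common closed neighbours from the minimum degree *)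

Lemma min_degree_le (T : finType) (e : rel T) v :
  (min_degree e <= degree e v)%N.
Proof.
rewrite /min_degree; elim: (index_enum T) (mem_index_enum v) => // u s IHs.
rewrite inE big_cons geq_min => /predU1P [->|/IHs->]; last exact: orbT.
by rewrite leqnn.
Qed.

(** Each [v] is among its own non-neighbours, so discarding it makes the bound
    [#|T| / m] on their number strict; hence the union bound still leaves a
    vertex when [S] has exactly [m] members. *)
Lemma common_closed_neighbour (T : finType) (e : rel T) (m : nat)
    (S : {set T}) :
  irreflexive e -> (0 < #|T|)%N ->
  (forall v, m * #|T| <= m * degree e v + #|T|)%N -> (#|S| <= m)%N ->
  exists w, forall v, v \in S -> v = w \/ e v w.
Proof.
move=> e_irr T_gt0 deg_ge S_le.
pose far v := ~: [set w | e v w] :\ v.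
have [all_far|] := boolP ([set: T] \subset \bigcup_(v in S) far v); last first.
  case/subsetPn => w _ w_near; exists w => v vS.
  have [<-|neq_wv] := eqVneq w v; [by left | right].
  apply: contraR w_near => not_vw; apply/bigcupP; exists v => //.
  by rewrite !inE neq_wv.
have far_small v : (m * (#|far v|).+1 <= #|T|)%N.
  have -> : (#|far v|).+1 = #|~: [set w | e v w]|.
    by rewrite (cardsD1 v (~: _)) !inE e_irr.
  by rewrite cardsCs setCK mulnBr leq_subLR deg_ge.
have [S0|S_gt0] := posnP #|S|.
  have [w _] := card_gt0P T_gt0.
  by exists w => v; rewrite (cards0_eq S0) inE.
have sum_far : (#|T| <= \sum_(v in S) #|far v|)%N.
  rewrite -cardsT (leq_trans (subset_leq_card all_far)) //.
  apply: (big_ind2 (fun (A : {set T}) k => #|A| <= k)%N) => [|A k B l hA hB|//].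
    by rewrite cards0.
  by rewrite (leq_trans (leq_card_setU A B)) ?leq_add.
have m_gt0 : (0 < m)%N by exact: leq_trans S_le.
have : (m * (\sum_(v in S) #|far v| + #|S|) <= m * #|T|)%N.
  rewrite -sum1_card -big_split big_distrr /=.
  apply: leq_trans (leq_mul S_le (leqnn #|T|)).
  by rewrite -sum_nat_const leq_sum // => v _; rewrite addn1.
rewrite leq_pmul2l // => /leq_trans/(_ sum_far).
by rewrite -[leqRHS]addn0 leq_add2l leqNgt S_gt0.
Qed.

(** * Components and covers *)

Lemma colour_graph_sym (T : finType) (r : nat) (e : rel T)
    (col : edge_colouring T r) (i : 'I_r) :
  symmetric e -> connect_sym (colour_graph e col i).
Proof.
by move=> e_sym; apply: sym_connect_sym => x y; rewrite /colour_graph /= e_sym setUC.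
Qed.

Theorem theorem1p6 (r n : nat) (T : finType) (e : rel T)
    (col : edge_colouring T r) :
  (1 <= r)%N ->
  #|T| = n ->
  symmetric e -> irreflexive e ->
  (1 - 1 / 2%:R ^+ r) * n%:R <= (min_degree e)%:R :> rat ->
  exists C : {set 'I_r * {set T}},
    [/\ forall p, p \in C -> mono_component e col p.1 p.2,
        {in C &, injective (fun p : 'I_r * {set T} => p.1)}
      & \bigcup_(p in C) p.2 = [set: T]].
Proof.
move=> _ card_T e_sym e_irr min_deg.
have deg_ge v : (2 ^ r * #|T| <= 2 ^ r * degree e v + #|T|)%N.
  rewrite (@leq_trans (2 ^ r * min_degree e + #|T|)) //; last first.
    by rewrite leq_add2r leq_mul2l min_degree_le orbT.
  rewrite -(ler_nat rat) natrD !natrM natrX card_T -lerBlDr.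
  have pow_gt0 : 0 < 2%:R ^+ r :> rat by rewrite exprn_gt0.
  move: min_deg; rewrite -(ler_pM2l pow_gt0) mulrA mulrBr mulr1 mul1r.
  by rewrite divff ?gt_eqF // mulrBl mul1r.
have [T0|T_gt0] := posnP #|T|.
  exists set0; split=> [p|p q|]; rewrite ?inE //.
  by apply/setP => v; have := max_card (pred1 v); rewrite T0 card1.
have [t t_hits] : exists t : {ffun 'I_r -> T},
    forall v, exists i, fingraph.root (colour_graph e col i) v = t i.
  apply: hitting_helly => S; rewrite card_ord => S_small.
  have [w w_near] :=
    common_closed_neighbour _ _ _ _ e_irr T_gt0 deg_ge S_small.
  exists [ffun i => fingraph.root (colour_graph e col i) w] => v /w_near vw.
  exists (col [set v; w]); rewrite ffunE; apply/fingraph.rootP.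
    exact: colour_graph_sym.
  by case: vw => [->//|vw]; apply: connect1; rewrite /colour_graph /= vw eqxx.
(* An entry of [t] that is not a canonical representative hits no vertex; its
   component is included all the same, so every colour is used once. *)
exists [set (i, [set y | connect (colour_graph e col i) (t i) y]) | i : 'I_r].
split=> [p /imsetP [i _ ->]|p q /imsetP [i _ ->] /imsetP [j _ ->] /= ->//|].
  by exists (t i).
apply/setP => v; rewrite in_setT; apply/bigcupP.
have [i root_v] := t_hits v.
exists (i, [set y | connect (colour_graph e col i) (t i) y]).
  exact: imset_f.
by rewrite inE /= colour_graph_sym // -root_v connect_root.
Qed.
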